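(* Consider a hypothesis testing problem $(H_0,H_1)$ with an expectation-gap statistic given by $Z(m),\tau_0(m),\tau_1(m),\sigma(m)$, let $0\le\delta\le\rho\le1$, $t\in[\rho,1/16]$, and let $C>0$ be a constant. There is a constant $C'$ depending only on $C$ such that the following algorithm, with $L=\lceil C't^2/\rho^2\rceil$: sample $r\sim\mathrm{Unif}([1/4,3/4])$; take $L$ independent batches of $m_t$ samples and compute the statistics $\hat Z_1,\dots,\hat Z_L$; let $\hat V$ be their median; output accept if $\hat V<\tau_0(m_t)+\Delta(m_t)/8$ and reject if $\hat V>\tau_1(m_t)-\Delta(m_t)/8$; otherwise let $\hat W=\frac1L\sum_\ell\hat Z_\ell$ and output accept if $\hat W\le\tau_0(m_t)+r\Delta(m_t)$ and reject otherwise — has the following properties: it takes $O(m_t t^2/\rho^2)$ samples; it succeeds (accepts under $H_0$, rejects under $H_1$) with probability at least $1-t^{Ct^2/\rho^2}$; and it is $\rho$-replicable.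
   Context: An expectation-gap statistic for $(H_0,H_1)$ consists of a statistic $Z(m)$ computed from $m$ i.i.d. samples and real functions $\tau_0(m),\tau_1(m),\sigma(m)$ such that: $\mathbb{E}[Z(m)]\le\tau_0(m)$ for every distribution in $H_0$; $\mathbb{E}[Z(m)]\ge\tau_1(m)$ for every distribution in $H_1$; for some $m_{\min}\in\mathbb{N}$, $\tau_1(m)\ge\tau_0(m)$ for all $m\ge m_{\min}$; and for every sampling distribution, $\sqrt{\mathrm{Var}[Z(m)]}\le\sigma(m)\left(1+\max\left\{0,\frac{\mathbb{E}[Z(m)]-\tau_1(m)}{\Delta(m)},\frac{\tau_0(m)-\mathbb{E}[Z(m)]}{\Delta(m)}\right\}\right)$, where $\Delta(m)=\tau_1(m)-\tau_0(m)$. Let $f(m)=\sigma(m)/\Delta(m)$ and, for $t\in(0,1]$, $m_t=\min\{m\in\mathbb{N}: m\ge m_{\min},\ f(m)\le t/2\}$. An algorithm is $\rho$-replicable if for every sampling distribution, two runs on independent samples with the same internal randomness give the same output with probability at least $1-\rho$. *)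

(* Defs.v *)
From HB Require Import structures.
From mathcomp Require Import all_boot all_order all_algebra.
From mathcomp Require Import all_classical all_reals all_analysis.

Set Implicit Arguments.
Unset Strict Implicit.
Unset Printing Implicit Defensive.

Import Order.TTheory GRing.Theory Num.Theory.
Import numFieldNormedType.Exports.

Local Open Scope classical_set_scope.
Local Open Scope ring_scope.

Section iid.
Context (d : measure_display) (X : measurableType d) (R : realType).

Definition pair_cons n (x : X * n.-tuple X) : n.+1.-tuple X :=
  [tuple of x.1 :: x.2].

Lemma measurable_pair_cons n : measurable_fun setT (@pair_cons n).
Proof. exact: (measurable_cons measurable_fst measurable_snd). Qed.

HB.instance Definition _ n :=
  isMeasurableFun.Build _ _ _ _ (@pair_cons n) (@measurable_pair_cons n).

(* The law of n i.i.d. samples from P: the product probability on X^n, with the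
   product sigma-algebra that the library puts on n.-tuple X. *)
Fixpoint iid (P : probability X R) (n : nat) : probability (n.-tuple X) R :=
  match n with
  | 0 => \d_([tuple] : 0.-tuple X)
  | n.+1 => distribution (P \x iid P n)%E (@pair_cons n)
  end.

End iid.

Section algorithms.
Context (d dW : measure_display) (X : measurableType d) (W : measurableType dW).
Context (R : realType).

(* An algorithm using n samples from X and internal randomness in W.
   The output true means accept, false means reject. *)
Definition algorithm (n : nat) := n.-tuple X -> W -> bool.

Definition output_prob (mu : probability W R) (P : probability X R) n
    (A : algorithm n) (b : bool) : \bar R :=
  (iid P n \x mu)%E [set w | A w.1 w.2 = b].

Definition replicable (mu : probability W R) (rho : R) n (A : algorithm n) :=
  forall P : probability X R,
    ((1 - rho)%:E <=
     ((iid P n \x iid P n) \x mu) [set w | A w.1.1 w.2 = A w.1.2 w.2])%E.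

End algorithms.

Section statistic.
Context (d : measure_display) (X : measurableType d) (R : realType).

(* The hypothesis classes H0 and H1 are sets of distributions on X. *)
Record expectation_gap_statistic (H0 H1 : set (probability X R)) := {
  stat : forall m : nat, {mfun m.-tuple X >-> measurableTypeR R} ;
  tau0 : nat -> R ;
  tau1 : nat -> R ;
  sigma : nat -> R ;
  m_min : nat ;
  (* The expectations below are finite. *)
  stat_integrable : forall (P : probability X R) m,
    (iid P m).-integrable setT (EFin \o (stat m : m.-tuple X -> R)) ;
  stat_H0 : forall P m, H0 P -> ('E_(iid P m)[stat m] <= (tau0 m)%:E)%E ;
  stat_H1 : forall P m, H1 P -> ((tau1 m)%:E <= 'E_(iid P m)[stat m])%E ;
  tau_le : forall m, (m_min <= m)%N -> tau0 m <= tau1 m ;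
  (* The bound divides by tau1 m - tau0 m, so it is required only where this is
     nonzero. *)
  stat_var : forall (P : probability X R) m, tau1 m - tau0 m != 0 ->
    let mean := fine 'E_(iid P m)[stat m] in
    let Delta := tau1 m - tau0 m in
    (sqrte 'V_(iid P m)[stat m] <=
     (sigma m * (1 + Num.max 0 (Num.max ((mean - tau1 m) / Delta)
                                        ((tau0 m - mean) / Delta))))%:E)%E
}.

Context (H0 H1 : set (probability X R)) (S : expectation_gap_statistic H0 H1).

Definition gap (m : nat) : R := tau1 S m - tau0 S m.

(* f = sigma / Delta, read as +oo where Delta vanishes, including when sigma
   vanishes too (the field convention x / 0 = 0, or 0 * +oo = 0 in \bar R,
   would wrongly declare such m admissible). *)
Definition noise_ratio (m : nat) : \bar R :=
  if gap m == 0 then +oo%E else (sigma S m / gap m)%:E.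

Definition admissible (t : R) (m : nat) : bool :=
  (m_min S <= m)%N && (noise_ratio m <= (t / 2)%:E)%E.

(* m_t, defined as soon as some m is admissible. *)
Definition min_samples (t : R) (ht : exists m, admissible t m) : nat :=
  ex_minn ht.

End statistic.

(* The mean of the two middle order statistics; they coincide for odd length. *)
Definition median (R : realType) (s : seq R) : R :=
  let s' := sort (fun x y => x <= y) s in
  (s'`_((size s).-1./2) + s'`_((size s)./2)) / 2.

Lemma batch_index_subproof L m (l : 'I_L) (j : 'I_m) : (l * m + j < L * m)%N.
Proof.
apply: (@leq_trans (l.+1 * m)); first by rewrite mulSn addnC ltn_add2r.
by rewrite leq_mul2r ltn_ord orbT.
Qed.

Definition batch_index L m (l : 'I_L) (j : 'I_m) : 'I_(L * m) :=
  Ordinal (batch_index_subproof l j).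

(* The l-th of the L consecutive blocks of length m of x. *)
Definition batch (T : Type) L m (x : (L * m).-tuple T) (l : 'I_L) :
    m.-tuple T :=
  [tuple tnth x (batch_index l j) | j < m].

Lemma quarter_lt (R : realType) : (1 / 4 : R) < 3 / 4.
Proof. by rewrite ltr_pM2r ?invr_gt0 ?ltr0n// ltr1n. Qed.

Definition unif_threshold (R : realType) : probability (measurableTypeR R) R :=
  uniform_prob (quarter_lt R).

Definition median_mean_tester (d : measure_display) (X : measurableType d)
    (R : realType) (H0 H1 : set (probability X R))
    (S : expectation_gap_statistic H0 H1) (L m : nat) :
    algorithm X (measurableTypeR R) (L * m) :=
  fun x r =>
    let Z := [seq (stat S m (batch x l) : R) | l <- enum 'I_L] in
    let V := median Z in
    let What := L%:R^-1 * \sum_(z <- Z) z in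
    if V < tau0 S m + gap S m / 8 then true
    else if tau1 S m - gap S m / 8 < V then false
    else What <= tau0 S m + r * gap S m.

Arguments median_mean_tester {d X R H0 H1} S L m.

Definition num_batches (R : realType) (C' t rho : R) : nat :=
  `|Num.ceil (C' * t ^+ 2 / rho ^+ 2)|%N.

(* Main.v *)
(* The batch statistics are i.i.d., so everything happens on R^L under the
   product of the law of one statistic, with mean c and variance v. Write a for
   the distance from c to the cutoff that the median would have to cross.

   The median crosses it only if at least half of the values are a-far from c.
   Since sqrt v <= (4 t) a, Markov's inequality for the product of the weights
   1 + ((z - c) / (4 t a))^2, each of mean at most 2, bounds this probability by
   (4 t)^L 2^L = (8 t)^L. As (8 t)^4 <= t for t <= 1/16, this is at most
   t^(L/4), which gives correctness.

   For replicability both runs are compared with an answer that depends on the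
   threshold r only: accept if tau0 + r Delta is at least c, when c lies between
   tau0 and tau1. Because 1/4 <= r <= 3/4, this answer is never contradicted by
   the median alone unless the median is Delta/8 away from c; otherwise r must
   fall between the normalised values of c and of the empirical mean W, an event
   of probability 2 E|W - c| / Delta, controlled by the variance v / L of W. *)

Require Import Defs.
From HB Require Import structures.
From mathcomp Require Import all_boot all_order all_algebra.
From mathcomp Require Import all_classical all_reals all_analysis.
From mathcomp Require Import measurable_realfun.
From mathcomp Require Import ring lra zify.

Set Implicit Arguments.
Unset Strict Implicit.
Unset Printing Implicit Defensive.

Import Order.TTheory GRing.Theory Num.Theory.
Import numFieldNormedType.Exports.

Local Open Scope classical_set_scope.
Local Open Scope ring_scope.

(** * Order statistics *)

(** On a sorted list a downward closed predicate holds exactly on an initial segment, whose length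
    is its count. Statements about order statistics thereby become statements about counts. *)
Lemma sorted_nth_lower (R : realType) (s : seq R) (p : pred R) k :
  (forall x y, x <= y -> p y -> p x) -> sorted <=%R s -> (k < size s)%N ->
  p s`_k = (k < count p s)%N.
Proof.
move=> p_lower; elim: s k => [//|x s IHs] k xs_sorted.
have s_sorted := path_sorted xs_sorted.
have /allP x_le : all (>= x) s by apply: (order_path_min _ xs_sorted);
  exact: le_trans.
case: k => [_|k] /=.
  case px: (p x) => //=; symmetry; apply/negbTE; rewrite -leqNgt leqn0 add0n.
  rewrite -[_ == _]negbK -lt0n -has_count; apply/hasPn => y /x_le xy.
  by apply/negP => /(p_lower _ _ xy); rewrite px.
rewrite ltnS => k_lt; rewrite IHs//.
case px: (p x) => //=; rewrite add0n.
suff -> : count p s = 0%N by rewrite !ltn0.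
apply/eqP; rewrite -[_ == _]negbK -lt0n -has_count; apply/hasPn => y /x_le xy.
by apply/negP => /(p_lower _ _ xy); rewrite px.
Qed.

Lemma sort_nth_lower (R : realType) (s : seq R) (p : pred R) k :
  (forall x y, x <= y -> p y -> p x) -> (k < size s)%N ->
  p (sort (fun x y => x <= y) s)`_k = (k < count p s)%N.
Proof.
move=> p_lower ks; rewrite sorted_nth_lower ?size_sort//.
  by rewrite (permP (permEl (perm_sort _ _))).
by apply: sort_sorted; exact: le_total.
Qed.

(** Fewer than half of the values are [a]-far, so those at or below [c - a] cannot fill the
    positions up to the lower middle one, and those at or above [c + a] cannot fill the positions
    from the upper middle one on. Both middle order statistics lie strictly within [a] of [c], hence
    so does their mean. *)
Lemma median_near (R : realType) (s : seq R) (c a : R) :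
  (2 * count (fun z => a <= `|z - c|)%R s < size s)%N -> `|median s - c| < a.
Proof.
set far := count _ s => few.
have far_lo : (far <= (size s).-1./2)%N.
  by have := odd_double_half (size s).-1; move: few; rewrite -mul2n; lia.
have far_up : ((size s)./2 < size s - far)%N.
  by have := odd_double_half (size s); move: few; rewrite -mul2n; lia.
have middle k : ((size s).-1./2 <= k)%N -> (k <= (size s)./2)%N ->
    c - a < (sort (fun x y => x <= y) s)`_k < c + a.
  move=> k1 k2; have ks : (k < size s)%N by move: few; lia.
  apply/andP; split.
    rewrite ltNge (@sort_nth_lower _ _ (fun z => z <= c - a))//; last first.
      by move=> x y xy; exact: le_trans.
    have : (count (fun z => z <= c - a)%R s <= far)%N.
      by apply: sub_count => z /= zc; rewrite ler_normr; apply/orP; right; lra.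
    by rewrite -leqNgt => low; exact: leq_trans low (leq_trans far_lo k1).
  rewrite (@sort_nth_lower _ _ (fun z => z < c + a))//; last first.
    by move=> x y xy; exact: le_lt_trans.
  have : (count (predC (fun z => z < c + a)%R) s <= far)%N.
    apply: sub_count => z /=; rewrite -leNgt => zc.
    by rewrite ler_normr; apply/orP; left; lra.
  move=> up; apply: leq_ltn_trans k2 (leq_trans far_up _).
  by rewrite -(count_predC (fun z => z < c + a)%R s) leq_subLR addnC leq_add2r.
have /andP[l1 u1] := middle (size s).-1./2 (leqnn _) (half_leq (leq_pred _)).
have /andP[l2 u2] := middle (size s)./2 (half_leq (leq_pred _)) (leqnn _).
by rewrite ltr_norml /median; apply/andP; split; lra.
Qed.

(** * Products of i.i.d. samples *)

Lemma iid_integral_cons d (X : measurableType d) (R : realType)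
    (P : probability X R) n (f : n.+1.-tuple X -> \bar R) :
  measurable_fun [set: n.+1.-tuple X] f -> (forall z, 0 <= f z)%E ->
  (\int[iid P n.+1]_z f z =
   \int[P]_x \int[iid P n]_y f [tuple of x :: y])%E.
Proof.
move=> mf f0; rewrite ge0_integral_distribution//.
rewrite fubini_tonelli1//=.
exact: measurableT_comp.
Qed.

Definition split_tuple T m n (z : (m + n).-tuple T) : m.-tuple T * n.-tuple T :=
  ([tuple tnth z (lshift n i) | i < m], [tuple tnth z (rshift m i) | i < n]).

Lemma measurable_split_tuple d (X : measurableType d) m n :
  measurable_fun [set: (m + n).-tuple X] (@split_tuple X m n).
Proof.
apply/measurable_fun_pairP; split; apply/measurable_fun_tnthP => i /=;
  [rewrite (_ : _ \o _ = (@tnth _ X ^~ (lshift n i)))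
  |rewrite (_ : _ \o _ = (@tnth _ X ^~ (rshift m i)))];
  try exact: measurable_tnth; by apply/funext => z /=; rewrite tnth_mktuple.
Qed.

Lemma iid_cons d (X : measurableType d) (R : realType)
    (P : probability X R) n (A : set (n.+1.-tuple X)) :
  measurable A ->
  (iid P n.+1 A = \int[P]_x iid P n [set y : n.-tuple X | A [tuple of x :: y]])%E.
Proof.
move=> mA; rewrite /= /distribution /pushforward /= /product_measure1 /=.
apply: eq_integral => x _ /=; congr (iid P n _).
by rewrite /xsection; apply/seteqP; split => y /=; rewrite inE.
Qed.

Lemma measurable_consl d (X : measurableType d) n (x : X) :
  measurable_fun [set: n.-tuple X] (fun y : n.-tuple X => [tuple of x :: y]).
Proof. exact: measurable_cons. Qed.

Lemma measurable_iid_cons d (X : measurableType d) (R : realType)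
    (P : probability X R) n (A : set (n.+1.-tuple X)) :
  measurable A -> measurable_fun [set: X]
    (fun x => iid P n [set y : n.-tuple X | A [tuple of x :: y]]).
Proof.
move=> mA.
have mA' : measurable (@pair_cons _ X n @^-1` A).
  by rewrite -[X in measurable X]setTI; exact: measurable_pair_cons.
apply: eq_measurable_fun (measurable_fun_xsection (iid P n) mA') => x _ /=.
by congr (iid P n _); rewrite /xsection; apply/seteqP; split => y /=;
  rewrite inE.
Qed.

Lemma split_tuple_cons T m n (x : T) (y : (m + n).-tuple T) :
  split_tuple (m := m.+1) [tuple of x :: y] =
  ([tuple of x :: (split_tuple y).1], (split_tuple y).2).
Proof.
rewrite /split_tuple; congr (_, _); apply: eq_from_tnth => i; last first.
  by rewrite !tnth_mktuple !(tnth_nth x).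
rewrite tnth_mktuple; case: (unliftP ord0 i) => [j ->|->]; last first.
  by rewrite !(tnth_nth x).
by rewrite tnthS tnth_mktuple !(tnth_nth x).
Qed.

Lemma split_tuple0 T n (y : n.-tuple T) :
  split_tuple (m := 0) y = ([tuple], y).
Proof.
rewrite /split_tuple; congr (_, _); first exact: tuple0.
by apply: eq_from_tnth => i; rewrite tnth_mktuple; congr tnth; exact: val_inj.
Qed.

(** Independence of the first [m] and the last [n] samples. Rectangles suit the induction on [m]:
    fixing the first sample of a rectangle leaves a rectangle. *)
Lemma iid_split d (X : measurableType d) (R : realType) (P : probability X R)
    m n (A : set (m.-tuple X)) (B : set (n.-tuple X)) :
  measurable A -> measurable B ->
  (iid P (m + n) (@split_tuple X m n @^-1` (A `*` B)) = iid P m A * iid P n B)%E.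
Proof.
elim: m A => [|m IHm] A mA mB.
  have -> : @split_tuple X 0 n = fun y => ([tuple], y).
    by apply/funext => y; exact: split_tuple0.
  rewrite /= diracE; have [A0|A0] := boolP ([tuple] \in A).
    rewrite mul1e; congr (iid P n _); apply/seteqP; split => y /=;
      first by case.
    by split => //; rewrite inE in A0.
  rewrite mul0e; apply/eqP; rewrite -[X in _ == X](measure0 (iid P n));
    apply/eqP.
  congr (iid P n _); apply/seteqP; split => y //= -[].
  by move: A0; rewrite notin_setE.
pose AB := @split_tuple X m.+1 n @^-1` (A `*` B).
have mAB : measurable (AB : set ((m + n).+1.-tuple X)).
  rewrite -[X in measurable X]setTI.
  exact: (measurable_split_tuple measurableT (measurableX mA mB)).
rewrite [LHS](iid_cons P mAB) (iid_cons P mA) -ge0_integralZr//; last first.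
  exact: measurable_iid_cons.
apply: eq_integral => x _ /=.
rewrite -IHm//; last first.
  by rewrite -[X in measurable X]setTI;
    exact: (@measurable_consl _ X m x measurableT _ mA).
congr (iid P _ _).
rewrite -[LHS]/((fun y : (m + n).-tuple X =>
  @split_tuple X m.+1 n [tuple of x :: y]) @^-1` (A `*` B)).
by under eq_fun do rewrite split_tuple_cons.
Qed.

HB.instance Definition _ d (X : measurableType d) m n :=
  isMeasurableFun.Build _ _ _ _ (@split_tuple X m n)
    (@measurable_split_tuple _ X m n).

(** Rectangles determine a product measure, so [iid_split] extends to every measurable set. *)
Lemma iid_split_prod d (X : measurableType d) (R : realType)
    (P : probability X R) m n (E : set (m.-tuple X * n.-tuple X)) :
  measurable E ->
  (iid P (m + n) (@split_tuple X m n @^-1` E) = (iid P m \x iid P n) E)%E.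
Proof.
move=> mE; symmetry.
have H A B : measurable A -> measurable B ->
    (distribution (iid P (m + n)) (@split_tuple X m n) (A `*` B) =
     iid P m A * iid P n B)%E by exact: iid_split.
exact: (product_measure_unique H mE).
Qed.

Definition batch_map T U L m (Z : m.-tuple T -> U) (x : (L * m).-tuple T) :
    L.-tuple U :=
  [tuple Z (batch x l) | l < L].

Lemma measurable_batch_map d d' (X : measurableType d) (Y : measurableType d')
    L m (Z : {mfun m.-tuple X >-> Y}) :
  measurable_fun [set: (L * m).-tuple X] (@batch_map X Y L m Z).
Proof.
apply/measurable_fun_tnthP => l.
rewrite (_ : _ \o _ = Z \o (fun x => batch x l)); last first.
  by apply/funext => x /=; rewrite tnth_mktuple.
apply: measurableT_comp => //; apply/measurable_fun_tnthP => j.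
rewrite (_ : _ \o _ = (@tnth _ X ^~ (batch_index l j))).
  exact: measurable_tnth.
by apply/funext => x /=; rewrite tnth_mktuple.
Qed.

Lemma batch_map_cons T U L m (Z : m.-tuple T -> U) (x : (m + L * m).-tuple T) :
  batch_map (L := L.+1) Z x =
  [tuple of Z (split_tuple x).1 :: batch_map Z (split_tuple x).2].
Proof.
apply: eq_from_tnth => l; rewrite tnth_mktuple.
case: (unliftP ord0 l) => [k ->|->].
  rewrite tnthS tnth_mktuple; congr Z; apply: eq_from_tnth => j.
  rewrite !tnth_mktuple; congr tnth; apply: val_inj => /=.
  by rewrite /bump leq0n add1n mulSn addnA.
rewrite tnth0; congr Z; apply: eq_from_tnth => j.
by rewrite !tnth_mktuple; congr tnth; apply: val_inj.
Qed.

(** Disjoint blocks of an i.i.d. sample are independent, so the batch statistics are themselves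
    i.i.d. The induction splits off the first block and treats the remaining ones slice by slice. *)
Lemma iid_batch_map d d' (X : measurableType d) (Y : measurableType d')
    (R : realType) (P : probability X R) L m (Z : {mfun m.-tuple X >-> Y})
    (A : set (L.-tuple Y)) :
  measurable A ->
  iid P (L * m) (@batch_map X Y L m Z @^-1` A) =
  iid (distribution (iid P m) Z) L A.
Proof.
elim: L A => [|L IHL] A mA.
  rewrite /= !diracE; congr (_%:R%:E); congr nat_of_bool.
  have batch_map0 : @batch_map X Y 0 m Z [tuple] = [tuple] by exact: tuple0.
  by apply/idP/idP; rewrite !inE /preimage/= batch_map0.
pose E := [set w : m.-tuple X * (L * m).-tuple X |
           A [tuple of Z w.1 :: batch_map Z w.2]].
have mE : measurable E.
  rewrite -[X in measurable X]setTI.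
  apply: (@measurable_cons _ _ _ _ (Z \o fst) L (@batch_map X Y L m Z \o snd)) => //.
    exact: measurableT_comp.
  apply: measurableT_comp => //; exact: measurable_batch_map.
have -> : @batch_map X Y L.+1 m Z @^-1` A = @split_tuple X m (L * m) @^-1` E.
  by apply/seteqP; split => x; rewrite /E /preimage/= batch_map_cons.
rewrite [LHS](iid_split_prod P mE) (iid_cons _ mA) ge0_integral_distribution//; last first.
  exact: measurable_iid_cons.
apply: eq_integral => x _ /=.
rewrite -IHL//; last first.
  by rewrite -[X in measurable X]setTI;
    exact: (@measurable_consl _ Y L (Z x) measurableT _ mA).
by congr (iid P _ _); rewrite /xsection; apply/seteqP; split => y /=;
  rewrite inE.
Qed.

(** * Moments *)

Lemma probability_integral_cst d (T : measurableType d) (R : realType)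
  (Q : probability T R) (k : \bar R) : (\int[Q]_x k = k)%E.
Proof. by rewrite integral_cst//= probability_setT mule1. Qed.

Section moments.
Context d (X : measurableType d) (R : realType) (P : probability X R).
Local Open Scope ereal_scope.

Lemma iid_integral_tnth n (i : 'I_n) (f : X -> \bar R) :
  measurable_fun [set: X] f -> (forall x, 0 <= f x) ->
  \int[iid P n]_z f (tnth z i) = \int[P]_x f x.
Proof.
move=> mf f0; elim: n i => [|n IHn] i; first by case: i.
have mfi : measurable_fun [set: n.+1.-tuple X] (fun z => f (tnth z i)).
  exact: measurableT_comp (measurable_tnth i).
rewrite iid_integral_cons//; case: (unliftP ord0 i) => [j ->|->].
  under eq_integral do under eq_integral do rewrite tnthS.
  rewrite IHn probability_integral_cst.
  by [].
under eq_integral do under eq_integral do rewrite tnth0.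
by under eq_integral do rewrite probability_integral_cst.
Qed.

(** Independence turns the mean of a product into the product of the means; since [h] is
    nonnegative, Tonelli applies at each sample. *)
Lemma iid_integral_prod n (h : X -> R) (e : R) :
  measurable_fun [set: X] h -> (forall x, 0 <= h x)%R ->
  \int[P]_x (h x)%:E = e%:E ->
  \int[iid P n]_z (\prod_(i < n) h (tnth z i))%:E = (e ^+ n)%:E.
Proof.
move=> mh h0 he.
have e0 : (0 <= e)%R.
  by rewrite -lee_fin -he; apply: integral_ge0 => x _; rewrite lee_fin.
have mprod k : measurable_fun [set: k.-tuple X]
    (fun z => (\prod_(i < k) h (tnth z i))%:E).
  apply/measurable_EFinP; apply: measurable_prod => i _.
  exact: measurableT_comp (measurable_tnth i).
have prod0 k (z : k.-tuple X) : 0 <= (\prod_(i < k) h (tnth z i))%:E.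
  by rewrite lee_fin prodr_ge0.
elim: n => [|n IHn].
  under eq_integral do rewrite big_ord0.
  by rewrite probability_integral_cst expr0.
rewrite iid_integral_cons//.
transitivity (\int[P]_x ((e ^+ n)%:E * (h x)%:E)).
  apply: eq_integral => x _; rewrite muleC -IHn -ge0_integralZl// ?lee_fin//;
    last exact: mprod.
  apply: eq_integral => y _; rewrite big_ord_recl tnth0 EFinM.
  by under eq_bigr do rewrite tnthS.
rewrite ge0_integralZl ?he ?lee_fin ?exprn_ge0//; last 2 first.
- exact/measurable_EFinP.
- by move=> x _; rewrite lee_fin.
by rewrite -EFinM exprSr.
Qed.

Section centered.
Variables (f : X -> R) (v : R).
Hypotheses (f_int : P.-integrable setT (EFin \o f)) (f_mean : \int[P]_x (f x)%:E = 0)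
  (f_var : \int[P]_x (f x ^+ 2)%:E = v%:E).

Let mf : measurable_fun [set: X] f.
Proof. by apply/measurable_EFinP; exact: measurable_int f_int. Qed.

Let mfi n (i : 'I_n) : measurable_fun [set: n.-tuple X] (fun z => f (tnth z i)).
Proof. exact: measurableT_comp (measurable_tnth i). Qed.

Let msum n : measurable_fun [set: n.-tuple X] (fun z => \sum_(i < n) f (tnth z i))%R.
Proof. by apply: measurable_sum => i; exact: mfi. Qed.

Lemma iid_integrable_tnth n (i : 'I_n) :
  (iid P n).-integrable setT (fun z => (f (tnth z i))%:E).
Proof.
apply/integrableP; split; first by apply/measurable_EFinP; exact: mfi.
rewrite (iid_integral_tnth i (f := fun x => `|(f x)%:E|))//; last first.
  by apply: measurableT_comp => //; exact/measurable_EFinP.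
by have /integrableP[] := f_int.
Qed.

Lemma iid_integral_sum n : \int[iid P n]_z (\sum_(i < n) f (tnth z i))%:E = 0.
Proof.
under eq_integral do rewrite -sumEFin.
rewrite integral_sum//; last exact: iid_integrable_tnth.
rewrite big1// => i _.
(* [iid_integral_tnth] concerns nonnegative integrands, so the positive and negative parts are
   treated separately. *)
rewrite -[LHS]/(\int[iid P n]_z ((EFin \o f) \o (@tnth n X ^~ i)) z) integralE.
rewrite funepos_comp funeneg_comp.
rewrite (iid_integral_tnth i (f := (EFin \o f)^\+))//; last first.
  by apply: measurable_funepos; exact/measurable_EFinP.
rewrite (iid_integral_tnth i (f := (EFin \o f)^\-))//; last first.
  by apply: measurable_funeneg; exact/measurable_EFinP.
by rewrite -integralE.
Qed.

(** In the square of [f x] plus the remaining sum, the cross term has mean zero because the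
    remaining sum is centred. Each sample therefore contributes one [v]. *)
Lemma iid_integral_sqr_sum n :
  \int[iid P n]_z ((\sum_(i < n) f (tnth z i)) ^+ 2)%:E = (n%:R * v)%:E.
Proof.
have msqr k : measurable_fun [set: k.-tuple X]
    (fun z => ((\sum_(i < k) f (tnth z i)) ^+ 2)%:E).
  by apply/measurable_EFinP; apply: measurable_funX; exact: msum.
elim: n => [|n IHn].
  under eq_integral do rewrite big_ord0 expr0n/=.
  by rewrite integral0 mul0r.
have sum_int : (iid P n).-integrable setT
    (fun z => (\sum_(i < n) f (tnth z i))%:E).
  under eq_fun do rewrite -sumEFin.
  by apply: integrable_sum => // i _; exact: iid_integrable_tnth.
have sqr_int : (iid P n).-integrable setT
    (fun z => ((\sum_(i < n) f (tnth z i)) ^+ 2)%:E).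
  apply/integrableP; split; first exact: msqr.
  under eq_integral do rewrite gee0_abs ?lee_fin ?sqr_ge0//.
  by rewrite IHn ltry.
rewrite iid_integral_cons//; last by move=> z; rewrite lee_fin sqr_ge0.
transitivity (\int[P]_x ((f x ^+ 2)%:E + (n%:R * v)%:E)).
  apply: eq_integral => x _.
  transitivity (\int[iid P n]_y ((f x ^+ 2)%:E +
      ((2 * f x)%:E * (\sum_(i < n) f (tnth y i))%:E +
       ((\sum_(i < n) f (tnth y i)) ^+ 2)%:E))).
    apply: eq_integral => y _; rewrite big_ord_recl tnth0 -EFinM -!EFinD.
    under eq_bigr do rewrite tnthS.
    by congr EFin; ring.
  rewrite integralD//; last 2 first.
  - exact: finite_measure_integrable_cst.
  - by apply: integrableD => //; exact: integrableZl.
  rewrite probability_integral_cst; congr (_ + _).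
  rewrite integralD//; last exact: integrableZl.
  by rewrite integralZl// iid_integral_sum mule0 add0e IHn.
rewrite ge0_integralD//; last 3 first.
- by move=> x _; rewrite lee_fin sqr_ge0.
- by apply/measurable_EFinP; exact: measurable_funX.
- move=> x _; rewrite lee_fin mulr_ge0// -lee_fin -f_var.
  by apply: integral_ge0 => y _; rewrite lee_fin sqr_ge0.
rewrite f_var probability_integral_cst -EFinD.
by congr EFin; rewrite mulrSr; ring.
Qed.

End centered.
End moments.

(** * The tester as a function of the batch values *)

Lemma tuple_count_sum T n (p : pred T) (z : n.-tuple T) :
  count p z = (\sum_(i < n) p (tnth z i))%N.
Proof. by rewrite -sum1_count big_mkcond big_tuple; apply: eq_bigr => i _;
  case: p. Qed.

Section measurability.
Context (R : realType).
Let Rm := measurableTypeR R.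

(** The count is rewritten as a real sum of indicators, to which measurability of sums and
    comparisons applies. *)
Lemma measurable_fun_nat_sum d (T : measurableType d) n (b : 'I_n -> T -> bool) k :
  (forall i, measurable_fun [set: T] (b i)) ->
  measurable_fun [set: T] (fun x => k < \sum_(i < n) b i x)%N.
Proof.
move=> mb.
have -> : (fun x => k < \sum_(i < n) b i x)%N =
    (fun x => k%:R < \sum_(i < n) (if b i x then 1 else 0) :> R).
  apply/funext => x; rewrite -(ltr_nat R) natr_sum; congr (_ < _).
  by apply: eq_bigr => i _; case: (b i x).
apply: measurable_fun_ltr; first exact: measurable_cst.
apply: measurable_sum => i; apply: measurable_fun_ifT; first exact: mb.
  exact: measurable_cst.
exact: measurable_cst.
Qed.

(** The order statistic at index [k] is below [c] iff more than [k] coordinates are, and the rays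
    []-oo, c[] generate the Borel sets. *)
Lemma measurable_sort_nth n k :
  measurable_fun [set: n.-tuple Rm]
    (fun z => (sort (fun x y : R => x <= y) z)`_k : Rm).
Proof.
(* Beyond the length, [nth] returns its default 0 and the function is constant. *)
have [kn|nk] := ltnP k n; last first.
  rewrite (_ : (fun _ => _) = cst 0); first exact: measurable_cst.
  by apply/funext => z /=; rewrite nth_default// size_sort size_tuple.
move=> mD; apply: (measurability _ (RGenInftyO.measurableE R)) => //.
move=> _ [_ [c -> <-]].
rewrite setTI.
have -> : (fun z : n.-tuple Rm => (sort (fun x y : R => x <= y) z)`_k : Rm) @^-1`
    `]-oo, c[ =
    (fun z : n.-tuple Rm => (k < \sum_(i < n) (tnth z i < c)%R)%N) @^-1` [set true].
  apply/seteqP; split => z /=;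
    rewrite in_itv/= -(tuple_count_sum (fun x => x < c)%R);
    rewrite (@sort_nth_lower _ _ (fun x => x < c)) ?size_tuple//;
    by move=> x y xy; exact: le_lt_trans.
rewrite -[X in measurable X]setTI; apply: measurable_fun_nat_sum => // i.
apply: measurable_fun_ltr; last exact: measurable_cst.
exact: measurable_tnth.
Qed.

Lemma measurable_median n :
  measurable_fun [set: n.-tuple Rm] (fun z => median (z : seq R) : Rm).
Proof.
apply: measurable_funM; last exact: measurable_cst.
under eq_fun do rewrite size_tuple.
by apply: measurable_funD; exact: measurable_sort_nth.
Qed.

(** Convertible to [median_mean_tester] when [z] is the tuple of batch statistics and [t0], [t1] are
    the two thresholds, so that bounds proved here transfer along [batch_map]. *)
Definition threshold_rule (t0 t1 : R) L (z : L.-tuple R) (r : R) : bool :=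
  if median z < t0 + (t1 - t0) / 8 then true
  else if t1 - (t1 - t0) / 8 < median z then false
  else L%:R^-1 * \sum_(x <- z) x <= t0 + r * (t1 - t0).

Lemma measurable_threshold_rule t0 t1 L :
  measurable_fun [set: L.-tuple Rm * Rm]
    (fun w => threshold_rule t0 t1 w.1 w.2).
Proof.
have mmed : measurable_fun [set: L.-tuple Rm * Rm]
    (fun w => median (w.1 : seq R) : Rm).
  apply: (@measurableT_comp _ _ _ _ _ _
    (fun z : L.-tuple Rm => median (z : seq R) : Rm)) => //.
  exact: measurable_median.
apply: measurable_fun_ifT; [|exact: measurable_cst|].
  by apply: measurable_fun_ltr => //; exact: measurable_cst.
apply: measurable_fun_ifT; [|exact: measurable_cst|].
  by apply: measurable_fun_ltr => //; exact: measurable_cst.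
apply: measurable_fun_ler; last first.
  by apply: measurable_funD => //; apply: measurable_funM.
apply: measurable_funM => //.
under eq_fun do rewrite big_tuple.
apply: measurable_sum => i.
apply: (@measurableT_comp _ _ _ _ _ _ (@tnth _ Rm ^~ i)) => //.
exact: measurable_tnth.
Qed.

End measurability.

(** The density is 2 on [[1/4, 3/4]] and 0 elsewhere, so only the part of [A] inside that interval
    has to be confined to [[x, y]]. *)
Lemma unif_threshold_le (R : realType) (A : set R) (x y : R) :
  measurable (A : set (measurableTypeR R)) -> x <= y ->
  (forall r, A r -> 1 / 4 <= r <= 3 / 4 -> x <= r <= y) ->
  (unif_threshold R A <= (2 * (y - x))%:E)%E.
Proof.
move=> mA xy Axy.
rewrite -[leLHS]/(\int[lebesgue_measure]_(r in A)
  (uniform_pdf (1 / 4) (3 / 4) r)%:E)%E integral_uniform_pdf.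
have mB : measurable (A `&` `[1 / 4, 3 / 4]%classic : set (measurableTypeR R)).
  exact: measurableI.
apply: le_trans.
  apply: (@ge0_le_integral _ (measurableTypeR R) R lebesgue_measure _ mB
    (fun r => (uniform_pdf (1 / 4) (3 / 4) r)%:E) (cst (2 : R)%:E)).
  - by move=> r _; rewrite lee_fin uniform_pdf_ge0// quarter_lt.
  - by apply/measurable_EFinP/measurable_funTS; exact: measurable_uniform_pdf.
  - exact: measurable_cst.
  - move=> r _; rewrite lee_fin /uniform_pdf; case: ifP => _ //=.
    have -> : 3 / 4 - 1 / 4 = 2^-1 :> R by lra.
    by rewrite invrK.
rewrite integral_cst//= EFinM lee_wpmul2l// ?lee_fin//.
apply: (@le_trans _ _ (lebesgue_measure `[x, y]%classic)).
  apply: le_measure; rewrite ?inE//.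
  by move=> r [Ar]; rewrite /= !in_itv/= => /Axy; exact.
by rewrite lebesgue_measure_itv/= lte_fin; case: ltP => // yx;
  rewrite lee_fin; lra.
Qed.

Section threshold_rule_lemmas.
Context (R : realType) (t0 t1 c a : R) (L : nat) (z : L.-tuple R) (r : R).
Hypothesis t01 : t0 < t1.
Hypothesis few : (2 * count (fun x => a <= `|x - c|)%R z < L)%N.

Let near : `|median (z : seq R) - c| < a.
Proof. by apply: median_near; rewrite size_tuple. Qed.

Lemma threshold_rule_low : c + a <= t0 + (t1 - t0) / 8 ->
  threshold_rule t0 t1 z r = true.
Proof.
move=> ca; rewrite /threshold_rule ifT//.
by move: near; rewrite ltr_norml => /andP[_]; lra.
Qed.

Lemma threshold_rule_high : t1 - (t1 - t0) / 8 <= c - a ->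
  threshold_rule t0 t1 z r = false.
Proof.
move=> ca; move: near; rewrite ltr_norml => /andP[near1 _].
have high : t1 - (t1 - t0) / 8 < median z by lra.
(* The accept test comes first and must be ruled out as well; the two cutoffs are ordered because
   [t0 < t1]. *)
have low : t0 + (t1 - t0) / 8 <= median z.
  by move: t01; lra.
by rewrite /threshold_rule high ltNge low.
Qed.

(** If the median alone accepts, then [c] is below [t0] plus a quarter of the gap, hence below the
    random threshold as [r >= 1/4]; rejection is symmetric with [r <= 3/4]. A disagreement thus
    comes from the comparison with [W], and the threshold separates [c] from [W]. *)
Lemma threshold_rule_mid (W := L%:R^-1 * \sum_(x <- z) x) :
  a <= (t1 - t0) / 8 -> 1 / 4 <= r <= 3 / 4 ->
  threshold_rule t0 t1 z r != (c <= t0 + r * (t1 - t0)) ->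
  Num.min c W <= t0 + r * (t1 - t0) <= Num.max c W.
Proof.
move=> ha /andP[r1 r2]; move: near; rewrite ltr_norml => /andP[near1 near2].
have rD1 : 1 / 4 * (t1 - t0) <= r * (t1 - t0) by rewrite ler_wpM2r ?subr_ge0 ?(ltW t01).
have rD2 : r * (t1 - t0) <= 3 / 4 * (t1 - t0) by rewrite ler_wpM2r ?subr_ge0 ?(ltW t01).
rewrite /threshold_rule -/W ge_min le_max.
case: ltP => h1; first by case: leP => //= h2; lra.
case: ltP => h2; first by case: leP => //= h3; lra.
set T := t0 + _.
by case: (leP W T) => [|/ltW] h3; case: (leP c T) => [|/ltW] h4 //= _;
  rewrite ?h3 ?h4 ?orbT.
Qed.

End threshold_rule_lemmas.

(** Each entry selected by [p] absorbs one factor [s ^+ 2], and the other factors are at least 1.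
    This is the pointwise inequality behind the Markov bound on the count. *)
Lemma count_le_prod (R : realType) (s : R) (h : R -> R) (p : pred R) (zs : seq R) :
  0 <= s -> (forall x, 1 <= h x) -> (forall x, p x -> 1 <= s ^+ 2 * h x) ->
  1 <= s ^+ (2 * count p zs) * \prod_(x <- zs) h x.
Proof.
move=> s0 h1 hp; elim: zs => [|x zs IHzs].
  by rewrite big_nil /= muln0 expr0 mulr1.
rewrite big_cons /=; case px: (p x); last first.
  rewrite add0n mulrCA; apply: (le_trans IHzs); rewrite ler_peMl//.
  exact: le_trans ler01 IHzs.
rewrite mulnDr muln1 exprD mulrACA; apply: (le_trans IHzs);
  rewrite ler_peMl ?hp//.
exact: le_trans ler01 IHzs.
Qed.

(** * Failure probability *)

Section failure_bound.
Context (R : realType) (Q : probability (measurableTypeR R) R) (c v : R).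
Let Rm := measurableTypeR R.
Hypotheses (Q_int : Q.-integrable setT (fun x => (x - c)%:E))
  (Q_mean : (\int[Q]_x (x - c)%:E = 0)%E)
  (Q_var : (\int[Q]_x ((x - c) ^+ 2)%:E = v%:E)%E).
Variables (L : nat) (a s : R).
Hypotheses (a0 : 0 < a) (s0 : 0 < s) (s1 : s <= 1) (vas : v <= (a * s) ^+ 2).

Let weight (x : R) : R := 1 + ((x - c) / (a * s)) ^+ 2.

Let weight_ge1 x : 1 <= weight x.
Proof. by rewrite lerDl sqr_ge0. Qed.

(* At least 1 as soon as half of the values are a-far from c, and of mean at
   most (2 s)^L. *)
Definition deviation (z : L.-tuple R) : R :=
  s ^+ L * \prod_(i < L) (1 + ((tnth z i - c) / (a * s)) ^+ 2).

Lemma deviation_ge0 z : 0 <= deviation z.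
Proof.
by rewrite mulr_ge0 ?exprn_ge0 ?(ltW s0)// prodr_ge0// => i _;
  rewrite addr_ge0 ?sqr_ge0.
Qed.

(** For a far value, [s ^+ 2 * weight x] equals [s ^+ 2 + ((x - c) / a) ^+ 2], which is at least 1,
    so [count_le_prod] applies. Twice the count is at least [L] and [s <= 1], so lowering the
    exponent of [s] to [L] only increases the power. *)
Lemma deviation_ge1 (z : L.-tuple R) :
  (L <= 2 * count (fun x => a <= `|x - c|)%R z)%N -> 1 <= deviation z.
Proof.
move=> many.
apply: (@le_trans _ _ (s ^+ (2 * count (fun x => a <= `|x - c|)%R z) *
    \prod_(x <- z) weight x)).
  apply: count_le_prod => // [|x far]; first exact: ltW.
  have -> : s ^+ 2 * weight x = s ^+ 2 + ((x - c) / a) ^+ 2.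
    by rewrite /weight; field; rewrite !gt_eqF.
  apply: (@le_trans _ _ (((x - c) / a) ^+ 2)); last by rewrite lerDr sqr_ge0.
  rewrite -[1](expr1n _ 2) -[leRHS]real_normK ?num_real// lerXn2r ?nnegrE//.
  by rewrite normrM normfV (gtr0_norm a0) ler_pdivlMr// mul1r.
rewrite big_tuple ler_wpM2r//; last by rewrite ler_wiXn2l// ltW.
by apply: prodr_ge0 => i _; exact: le_trans ler01 (weight_ge1 _).
Qed.

Let mweight : measurable_fun [set: Rm] weight.
Proof.
apply: measurable_funD; first exact: measurable_cst.
apply: measurable_funX; apply: measurable_funM; last exact: measurable_cst.
by apply: measurable_funB => //; exact: measurable_cst.
Qed.

Let msqr : measurable_fun [set: Rm] (fun x : R => (x - c) ^+ 2).
Proof.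
apply: measurable_funX.
by apply: measurable_funB => //; exact: measurable_cst.
Qed.

Lemma weight_integral :
  (\int[Q]_x (weight x)%:E = (1 + (a * s) ^- 2 * v)%:E)%E.
Proof.
transitivity (\int[Q]_x ((1 : R)%:E + ((a * s) ^- 2)%:E * ((x - c) ^+ 2)%:E))%E.
  apply: eq_integral => x _; rewrite -EFinM -EFinD; congr EFin.
  by rewrite /weight exprMn exprVn mulrC.
have as2 : 0 <= (a * s) ^- 2 by rewrite invr_ge0 sqr_ge0.
rewrite ge0_integralD//; last 2 first.
- by move=> x _; rewrite -EFinM lee_fin mulr_ge0// sqr_ge0.
- by apply: measurable_funeM; exact/measurable_EFinP.
rewrite probability_integral_cst ge0_integralZl//; last 2 first.
- exact/measurable_EFinP.
- by move=> x _; rewrite lee_fin sqr_ge0.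
by rewrite Q_var -EFinM -EFinD.
Qed.

Let mdeviation : measurable_fun [set: L.-tuple Rm] (deviation : L.-tuple Rm -> R).
Proof.
apply: measurable_funM; first exact: measurable_cst.
apply: measurable_prod => i _.
exact: (measurableT_comp mweight (measurable_tnth i)).
Qed.

Lemma deviation_integral :
  (\int[iid Q L]_z (deviation z)%:E <= ((2 * s) ^+ L)%:E)%E.
Proof.
under eq_integral do rewrite /deviation EFinM.
rewrite ge0_integralZl//; last 3 first.
- apply/measurable_EFinP; apply: measurable_prod => i _.
  exact: (measurableT_comp mweight (measurable_tnth i)).
- move=> z _; rewrite lee_fin prodr_ge0// => i _.
  exact: le_trans ler01 (weight_ge1 _).
- by rewrite lee_fin exprn_ge0// ltW.
rewrite (@iid_integral_prod _ _ _ Q L weight _ mweight _ weight_integral);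
  last first.
  by move=> x; exact: le_trans ler01 (weight_ge1 _).
rewrite -EFinM lee_fin [in leRHS]exprMn [leLHS]mulrC ler_wpM2r ?exprn_ge0 ?(ltW s0)//.
have v0 : 0 <= v.
  by rewrite -lee_fin -Q_var; apply: integral_ge0 => x _;
    rewrite lee_fin sqr_ge0.
rewrite lerXn2r ?nnegrE ?addr_ge0 ?mulr_ge0 ?invr_ge0 ?sqr_ge0//.
(* By [vas], each weight has mean at most 2. *)
by rewrite (_ : 2 = 1 + 1)// lerD2l ler_pdivrMl ?mulr1// exprn_gt0 ?mulr_gt0.
Qed.

(** Common template for all failure bounds: a bound on the slices at fixed batch values is
    integrated term by term. Constant answers take [al = be = 0]; the quadratic term serves the
    answers that depend on [r], through the variance of the empirical mean. *)
Lemma failure_le d (T : measurableType d) (mu : probability T R) (al be : R)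
    (A : set (L.-tuple Rm * T)) :
  0 <= al -> 0 <= be -> measurable A ->
  (forall z, mu (xsection A z) <=
    (deviation z + (al + be * (\sum_(i < L) (tnth z i - c)) ^+ 2))%:E)%E ->
  ((iid Q L \x mu) A <= ((2 * s) ^+ L + (al + be * (L%:R * v)))%:E)%E.
Proof.
move=> al0 be0 mA hA; rewrite /product_measure1.
have msum : measurable_fun [set: L.-tuple Rm]
    (fun z => (\sum_(i < L) (tnth z i - c)) ^+ 2 : R).
  apply: measurable_funX; apply: measurable_sum => i.
  by apply: measurable_funB; [exact: measurable_tnth|exact: measurable_cst].
apply: (@le_trans _ _ (\int[iid Q L]_z ((deviation z)%:E +
    (al%:E + be%:E * ((\sum_(i < L) (tnth z i - c)) ^+ 2)%:E)))%E).
  apply: ge0_le_integral => //.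
  - exact: measurable_fun_xsection.
  - apply: emeasurable_funD; first exact/measurable_EFinP.
    apply: emeasurable_funD; first exact: measurable_cst.
    by apply: measurable_funeM; exact/measurable_EFinP.
  - by move=> z _; rewrite -EFinM -!EFinD; exact: hA.
rewrite ge0_integralD//; last 4 first.
- by move=> z _; rewrite lee_fin deviation_ge0.
- exact/measurable_EFinP.
- move=> z _; rewrite -EFinM -EFinD lee_fin; apply: addr_ge0 => //;
  apply: mulr_ge0 => //; exact: sqr_ge0.
- apply: emeasurable_funD; first exact: measurable_cst.
  by apply: measurable_funeM; exact/measurable_EFinP.
rewrite EFinD leeD//; first exact: deviation_integral.
rewrite ge0_integralD//; last 2 first.
- by move=> z _; rewrite -EFinM lee_fin mulr_ge0 ?sqr_ge0.
- by apply: measurable_funeM; exact/measurable_EFinP.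
rewrite probability_integral_cst ge0_integralZl//; last 2 first.
- exact/measurable_EFinP.
- by move=> x _; rewrite lee_fin sqr_ge0.
by rewrite (@iid_integral_sqr_sum _ _ _ Q (fun x => x - c) v).
Qed.

End failure_bound.

Lemma measurable_neq_bool d (T : measurableType d) (f g : T -> bool) :
  measurable_fun [set: T] f -> measurable_fun [set: T] g ->
  measurable [set x | f x != g x].
Proof.
move=> mf mg.
have -> : [set x | f x != g x] =
    (fun x => (f x && ~~ g x) || (~~ f x && g x)) @^-1` [set true].
  by apply/seteqP; split => x /=; case: (f x); case: (g x).
rewrite -[X in measurable X]setTI.
by apply: measurable_or => //; apply: measurable_and => //;
  exact: measurable_neg.
Qed.

Section tester_on_values.
Context (R : realType) (Q : probability (measurableTypeR R) R) (c v : R).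
Let Rm := measurableTypeR R.
Hypotheses (Q_int : Q.-integrable setT (fun x => (x - c)%:E))
  (Q_mean : (\int[Q]_x (x - c)%:E = 0)%E)
  (Q_var : (\int[Q]_x ((x - c) ^+ 2)%:E = v%:E)%E).
Variables (t0 t1 t : R) (L : nat).
Hypotheses (t01 : t0 < t1) (t_gt0 : 0 < t) (t_le : t <= 1 / 16).
Hypothesis v_le :
  v <= (t / 2 * (t1 - t0 + Num.max 0 (Num.max (c - t1) (t0 - c)))) ^+ 2.

Let s0 : 0 < 4 * t. Proof. by move: t_gt0; lra. Qed.
Let s1 : 4 * t <= 1. Proof. by move: t_le; lra. Qed.
Let s8 : 2 * (4 * t) = 8 * t. Proof. by rewrite mulrA -natrM. Qed.

Let measurable_rule (b : Rm -> bool) : measurable_fun [set: Rm] b ->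
  measurable [set w : L.-tuple Rm * Rm | threshold_rule t0 t1 w.1 w.2 != b w.2].
Proof.
move=> mb; apply: measurable_neq_bool; first exact: measurable_threshold_rule.
exact: (measurableT_comp mb measurable_snd).
Qed.

(** A slice is empty when fewer than half of the values are far; otherwise [deviation] is at least 1
    and bounds any probability. *)
Let const_failure (mu : probability Rm R) (a : R) (b : bool) :
  0 < a -> v <= (a * (4 * t)) ^+ 2 ->
  (forall (z : L.-tuple R) r,
    (2 * count (fun x => a <= `|x - c|)%R z < L)%N ->
    threshold_rule t0 t1 z r = b) ->
  ((iid Q L \x mu) [set w : L.-tuple Rm * Rm |
     threshold_rule t0 t1 w.1 w.2 != b] <= ((8 * t) ^+ L)%:E)%E.
Proof.
move=> a0 va few_b.
have mA := measurable_rule (measurable_cst b).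
have := failure_le Q_int Q_mean Q_var a0 s0 va (mu := mu) (lexx 0) (lexx 0) mA.
rewrite s8 mul0r !addr0; apply => z; rewrite mul0r !addr0.
have [few|many] := ltnP (2 * count (fun x => a <= `|x - c|)%R z)%N L.
  rewrite (_ : xsection _ _ = set0) ?measure0 ?lee_fin ?deviation_ge0//.
  by apply/seteqP; split => r //=; rewrite /xsection/= inE/= few_b// eqxx.
apply: (@le_trans _ _ 1%E); last by rewrite lee_fin; exact: deviation_ge1.
by apply: probability_le1; exact: measurable_xsection.
Qed.

(** Origin of the factor [4 * t]: it turns an eighth of the gap into exactly [t / 2] times the gap,
    while [4 * (t * u)] more than covers the part of the deviation bound due to a mean outside
    [[t0, t1]]. The number [(t1 - t0) / 8 + u] is the distance from [c] to the cutoff when [u] is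
    the distance from [c] to that interval. *)
Let root_v (u : R) : 0 <= u -> Num.max 0 (Num.max (c - t1) (t0 - c)) <= u ->
  v <= (((t1 - t0) / 8 + u) * (4 * t)) ^+ 2.
Proof.
move=> u0 hu; apply: (le_trans v_le).
have D0 : 0 <= t1 - t0 by rewrite subr_ge0 ltW.
have m0 : 0 <= Num.max 0 (Num.max (c - t1) (t0 - c)) by rewrite le_max lexx.
have lhs0 : 0 <= t / 2 * (t1 - t0 + Num.max 0 (Num.max (c - t1) (t0 - c))).
  by rewrite mulr_ge0 ?divr_ge0 ?(ltW t_gt0)// (addr_ge0 D0 m0).
have rhs0 : 0 <= ((t1 - t0) / 8 + u) * (4 * t).
  by rewrite mulr_ge0 ?(ltW s0)// addr_ge0// divr_ge0.
rewrite lerXn2r ?nnegrE//.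
have tM : t * Num.max 0 (Num.max (c - t1) (t0 - c)) <= t * u by rewrite ler_pM2l.
have tu : 0 <= t * u by rewrite mulr_ge0 ?(ltW t_gt0).
move: (Num.max 0 _) tM {hu m0 lhs0} => M tM.
have -> : t / 2 * (t1 - t0 + M) = t / 2 * (t1 - t0) + t * M / 2 by field.
have -> : ((t1 - t0) / 8 + u) * (4 * t) = t / 2 * (t1 - t0) + 4 * (t * u) by field.
by rewrite lerD2l; lra.
Qed.

Lemma threshold_rule_low_failure (mu : probability Rm R) : c <= t0 ->
  ((iid Q L \x mu) [set w : L.-tuple Rm * Rm |
     threshold_rule t0 t1 w.1 w.2 != true] <= ((8 * t) ^+ L)%:E)%E.
Proof.
move=> ct; apply: (@const_failure mu ((t1 - t0) / 8 + (t0 - c))).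
- by move: t01; lra.
- apply: root_v; first by rewrite subr_ge0.
  by rewrite !ge_max; apply/andP; split; [|apply/andP; split]; move: t01; lra.
- by move=> z r few; apply: (threshold_rule_low r few); lra.
Qed.

Lemma threshold_rule_high_failure (mu : probability Rm R) : t1 <= c ->
  ((iid Q L \x mu) [set w : L.-tuple Rm * Rm |
     threshold_rule t0 t1 w.1 w.2 != false] <= ((8 * t) ^+ L)%:E)%E.
Proof.
move=> ct; apply: (@const_failure mu ((t1 - t0) / 8 + (c - t1))).
- by move: t01; lra.
- apply: root_v; first by rewrite subr_ge0.
  by rewrite !ge_max; apply/andP; split; [|apply/andP; split]; move: t01; lra.
- by move=> z r few; apply: (threshold_rule_high r t01 few); lra.
Qed.

Lemma threshold_rule_mid_failure (rho : R) : t0 <= c <= t1 ->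
  0 < rho -> 16 * t ^+ 2 / rho ^+ 2 <= L%:R -> (0 < L)%N ->
  ((iid Q L \x unif_threshold R) [set w : L.-tuple Rm * Rm |
     threshold_rule t0 t1 w.1 w.2 != (c <= t0 + (w.2 : R) * (t1 - t0))%R] <=
   ((8 * t) ^+ L + rho / 4)%:E)%E.
Proof.
move=> /andP[t0c ct1] rho0 hL L0.
have D0 : 0 < t1 - t0 by rewrite subr_gt0.
have mb : measurable_fun [set: Rm] (fun r : Rm => c <= t0 + r * (t1 - t0)).
  apply: measurable_fun_ler; first exact: measurable_cst.
  apply: measurable_funD; first exact: measurable_cst.
  by apply: measurable_funM => //; exact: measurable_cst.
have a0 : 0 < (t1 - t0) / 8 by rewrite divr_gt0.
have va : v <= ((t1 - t0) / 8 * (4 * t)) ^+ 2.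
  by rewrite -[(t1 - t0) / 8]addr0; apply: root_v => //;
    rewrite !ge_max lexx !subr_le0 t0c ct1.
(* Coefficients of the AM-GM bound applied below to [2 * (y - x)]. After integration the two terms
   contribute at most [rho / 8] each. *)
pose al := rho / 8.
pose be := 8 / rho * (L%:R * (t1 - t0)) ^- 2.
have al0 : 0 <= al by rewrite divr_ge0// ltW.
have be0 : 0 <= be by rewrite mulr_ge0 ?divr_ge0 ?invr_ge0 ?sqr_ge0// ltW.
have mA := measurable_rule mb.
apply: le_trans (failure_le Q_int Q_mean Q_var a0 s0 va al0 be0 mA _) _.
  move=> z; set S := \sum_(i < L) _.
  have [few|many] := ltnP (2 * count (fun x => (t1 - t0) / 8 <= `|x - c|)%R z)%N L;
    last first.
    apply: (@le_trans _ _ 1%E).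
      by apply: probability_le1; exact: measurable_xsection.
    rewrite lee_fin; apply: (le_trans (deviation_ge1 a0 s0 s1 many)).
    by rewrite lerDl addr_ge0// mulr_ge0 ?sqr_ge0.
  pose W := L%:R^-1 * \sum_(x <- z) x.
  have LR0 : L%:R != 0 :> R by rewrite pnatr_eq0 -lt0n.
  have WS : W - c = L%:R^-1 * S.
    rewrite /W /S sumrB sumr_const card_ord big_tuple mulrBr; congr (_ - _).
    by rewrite -[c *+ L]mulr_natl mulKf.
  (* A disagreement forces [r] into [[x, y]], the interval between [c] and [W] in units of the
     gap. *)
  pose x := (Num.min c W - t0) / (t1 - t0).
  pose y := (Num.max c W - t0) / (t1 - t0).
  have yx : y - x = `|S| / (L%:R * (t1 - t0)).
    have -> : `|S| / (L%:R * (t1 - t0)) = `|W - c| / (t1 - t0).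
      by rewrite WS normrM normfV (ger0_norm (ler0n _ _)) invfM -mulrA mulrCA mulrA.
    rewrite /x /y -mulrBl; congr (_ / _).
    case: (leP c W) => cW; first by rewrite ger0_norm ?subr_ge0//; lra.
    by rewrite ltr0_norm ?subr_lt0//; lra.
  apply: (@le_trans _ _ (2 * (y - x))%:E).
    apply: unif_threshold_le.
    - exact: measurable_xsection.
    - by rewrite -subr_ge0 yx divr_ge0 ?mulr_ge0 ?(ltW D0).
    - move=> r; rewrite /xsection/= inE/= => Ar r34.
      have /andP[h1 h2] := threshold_rule_mid t01 few (lexx _) r34 Ar.
      by rewrite ler_pdivrMr// ler_pdivlMr// lerBlDl lerBrDl h1 h2.
  rewrite lee_fin; apply: (@le_trans _ _ (al + be * S ^+ 2)); last first.
    by rewrite lerDr deviation_ge0.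
  have -> : be * S ^+ 2 = 8 / rho * (y - x) ^+ 2.
    rewrite yx /be expr_div_n real_normK ?num_real//; field.
    by rewrite LR0 !gt_eqF.
  (* 2 u <= rho / 8 + 8 u^2 / rho, by AM-GM *)
  rewrite /al -subr_ge0.
  have -> : rho / 8 + 8 / rho * (y - x) ^+ 2 - 2 * (y - x) =
    8 / rho * (y - x - rho / 8) ^+ 2.
    by field; rewrite gt_eqF.
  by rewrite mulr_ge0 ?sqr_ge0 ?divr_ge0 ?(ltW rho0).
rewrite s8 lee_fin lerD2l /al.
suff : be * (L%:R * v) <= rho / 8 by lra.
have vD : v <= (t / 2 * (t1 - t0)) ^+ 2.
  move: v_le; rewrite (_ : Num.max 0 _ = 0) ?addr0//.
  by apply/max_idPl; rewrite ge_max !subr_le0 ct1 t0c.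
have LR : 0 < L%:R :> R by rewrite ltr0n.
apply: (@le_trans _ _ (be * (L%:R * (t / 2 * (t1 - t0)) ^+ 2))).
  by rewrite ler_wpM2l// ler_pM2l.
(* The left side is [2 * t ^+ 2 / (rho * L)], which is at most [rho / 8] exactly when [L] is at
   least [16 * t ^+ 2 / rho ^+ 2]; this fixes the constant 16. *)
have -> : be * (L%:R * (t / 2 * (t1 - t0)) ^+ 2) =
    (16 * t ^+ 2 / rho ^+ 2) * (rho / (8 * L%:R)).
  by rewrite /be; field; rewrite !gt_eqF.
apply: (@le_trans _ _ (L%:R * (rho / (8 * L%:R)))).
  by rewrite ler_wpM2r// divr_ge0 ?mulr_ge0 ?(ltW rho0).
by rewrite (_ : _ * _ = rho / 8)//; field; rewrite gt_eqF.
Qed.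

End tester_on_values.

(** * Transfer to samples *)

(** Change of variables in the integral of the slices: the internal randomness is untouched by
    [batch_map]. *)
Lemma iid_batch_map_prod d d' dT (X : measurableType d) (Y : measurableType d')
    (T : measurableType dT) (R : realType) (P : probability X R) (mu : probability T R)
    L m (Z : {mfun m.-tuple X >-> Y}) (E : set (L.-tuple Y * T)) :
  measurable E ->
  ((iid P (L * m) \x mu) [set w | E (batch_map Z w.1, w.2)] =
   (iid (distribution (iid P m) Z) L \x mu) E)%E.
Proof.
move=> mE; rewrite /product_measure1.
pose bm := @batch_map X Y L m Z.
have mbm : measurable_fun [set: (L * m).-tuple X] bm by exact: measurable_batch_map.
rewrite [RHS](eq_measure_integral (pushforward (iid P (L * m)) bm)); last first.
  by move=> A mA _; exact: esym (iid_batch_map P Z mA).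
rewrite ge0_integral_pushforward//; last exact: measurable_fun_xsection.
Qed.

Section triple_marginals.
Context d1 d2 d3 (T1 : measurableType d1) (T2 : measurableType d2)
  (T3 : measurableType d3) (R : realType) (m1 : probability T1 R)
  (m2 : probability T2 R) (m3 : probability T3 R).

(** In the joint law of two runs, the sample of the other run integrates out, leaving one run with
    the shared threshold. *)
Lemma product_marginal13 (F : set (T1 * T3)) : measurable F ->
  (((m1 \x m2) \x m3) [set w | F (w.1.1, w.2)] = (m1 \x m3) F)%E.
Proof.
move=> mF; rewrite [LHS]/product_measure1 [RHS]/product_measure1.
have mG := measurable_fun_xsection m3 mF.
transitivity (\int[(m1 \x m2)%E]_w (m3 \o xsection F) w.1)%E.
  by [].
rewrite fubini_tonelli1//=; last exact: (measurableT_comp mG measurable_fst).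
by apply: eq_integral => x _; rewrite -[RHS](probability_integral_cst m2).
Qed.

Lemma product_marginal23 (F : set (T2 * T3)) : measurable F ->
  (((m1 \x m2) \x m3) [set w | F (w.1.2, w.2)] = (m2 \x m3) F)%E.
Proof.
move=> mF; rewrite [LHS]/product_measure1 [RHS]/product_measure1.
have mG := measurable_fun_xsection m3 mF.
transitivity (\int[(m1 \x m2)%E]_w (m3 \o xsection F) w.2)%E.
  by [].
rewrite fubini_tonelli1//=; last exact: (measurableT_comp mG measurable_snd).
by rewrite -[RHS](probability_integral_cst m1).
Qed.

End triple_marginals.

Section statistic_law.
Context d (X : measurableType d) (R : realType) (H0 H1 : set (probability X R))
  (S : expectation_gap_statistic H0 H1) (P : probability X R) (m : nat).
Let Rm := measurableTypeR R.
Let Q : probability Rm R := distribution (iid P m) (stat S m).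
Let c : R := fine ('E_(iid P m)[stat S m])%E.
Let v : R := fine ('V_(iid P m)[stat S m])%E.

Let stat_sub_integrable :
  (iid P m).-integrable setT (fun x => (stat S m x - c)%:E).
Proof.
have := @integrableB _ _ _ (iid P m) _ measurableT _ _ (stat_integrable S P m)
  (finite_measure_integrable_cst (iid P m) c measurableT).
by apply: eq_integrable => // x _ /=; rewrite EFinB.
Qed.

Lemma stat_expectation : ('E_(iid P m)[stat S m] = c%:E)%E.
Proof.
rewrite /c fineK// unlock; exact: integrable_fin_num (stat_integrable S P m).
Qed.

Let msub : measurable_fun [set: Rm] (fun x : Rm => (x - c)%:E).
Proof.
apply/measurable_EFinP.
by apply: measurable_funB => //; exact: measurable_cst.
Qed.

Lemma stat_law_integrable : Q.-integrable setT (fun x => (x - c)%:E).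
Proof. by apply: integrable_pushforward. Qed.

Lemma stat_law_mean : (\int[Q]_x (x - c)%:E = 0)%E.
Proof.
rewrite integral_distribution//=.
under eq_integral do rewrite EFinB.
rewrite integralB//; last 2 first.
- exact: (stat_integrable S P m).
- exact: finite_measure_integrable_cst.
have := stat_expectation; rewrite unlock => ->.
by rewrite probability_integral_cst subee.
Qed.

Lemma stat_law_variance : (\int[Q]_x ((x - c) ^+ 2)%:E = 'V_(iid P m)[stat S m])%E.
Proof.
rewrite ge0_integral_distribution//; last 2 first.
- apply/measurable_EFinP; apply: measurable_funX; exact/measurable_EFinP.
- by move=> x; rewrite lee_fin sqr_ge0.
rewrite /variance covariance.unlock /c !expectation.unlock.
by apply: eq_integral => x _; rewrite /= expr2.
Qed.

(** An infinite [noise_ratio] at gap zero makes the gap of an admissible [m] nonzero, hence positive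
    by [tau_le]. Multiplying the relative excess by the gap clears its denominators, and
    admissibility replaces [sigma] by [t / 2] times the gap. *)
Lemma stat_law_variance_le (t : R) : admissible S t m -> 0 < gap S m /\
  (\int[Q]_x ((x - c) ^+ 2)%:E = v%:E)%E /\
  v <= (t / 2 * (tau1 S m - tau0 S m +
         Num.max 0 (Num.max (c - tau1 S m) (tau0 S m - c)))) ^+ 2.
Proof.
move=> /andP[mm]; rewrite /noise_ratio; case: ifPn => [//|gap0 st].
have gap_gt0 : 0 < gap S m by rewrite lt0r gap0 subr_ge0 tau_le.
split=> //.
have /= := stat_var P gap0; rewrite -/c -/(gap S m).
set M := Num.max 0 _ => hV.
have v0 := variance_ge0 (iid P m) (stat S m).
(* Finiteness of the variance comes from the real upper bound on its square root. *)
have Vfin : ('V_(iid P m)[stat S m])%E \is a fin_num.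
  rewrite -sqrte_fin_num// ge0_fin_numE ?sqrte_ge0//.
  exact: le_lt_trans hV (ltry _).
split; first by rewrite stat_law_variance fineK.
move: hV; rewrite -(fineK Vfin) -/v /= lee_fin => hV.
have v00 : 0 <= v by rewrite fine_ge0.
have D0 : 0 <= tau1 S m - tau0 S m by rewrite ltW.
pose u := Num.max 0 (Num.max (c - tau1 S m) (tau0 S m - c)).
have Mu : M * gap S m = u.
  by rewrite /M /u maxr_pMl ?ltW// mul0r maxr_pMl ?ltW// !divfK.
have u0 : 0 <= u by rewrite /u le_max lexx.
have M0 : 0 <= M by rewrite /M le_max lexx.
have sD : sigma S m <= t / 2 * gap S m by rewrite -ler_pdivrMr.
have vle : Num.sqrt v <= t / 2 * (gap S m + u).
  rewrite -Mu -{1}[gap S m]mul1r -mulrDl mulrA mulrAC; apply: (le_trans hV).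
  by rewrite ler_wpM2r// addr_ge0.
have rhs0 := le_trans (sqrtr_ge0 v) vle.
by rewrite -(sqr_sqrtr v00) lerXn2r ?nnegrE ?sqrtr_ge0.
Qed.

End statistic_law.

(** * Choice of the constants *)

Lemma num_batches_itv (R : realType) (C' t rho : R) : 0 <= C' -> 0 <= t -> 0 <= rho ->
  C' * t ^+ 2 / rho ^+ 2 <= (num_batches C' t rho)%:R < C' * t ^+ 2 / rho ^+ 2 + 1.
Proof.
move=> C0 t0 rho0; rewrite /num_batches; set x := _ / _.
have x0 : 0 <= x by rewrite divr_ge0 ?mulr_ge0 ?sqr_ge0.
(* The ceiling is nonnegative, so the absolute value in [num_batches] leaves it unchanged. *)
have -> : (`|Num.ceil x|%N)%:R = (Num.ceil x)%:~R :> R.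
  by rewrite natr_absz ger0_norm// ceil_ge0; apply: lt_le_trans x0;
    rewrite ltrN10.
have /andP[h1 h2] := ceil_itv x.
by rewrite h2 -ltrBlDr -[X in _ - X]/(1%:~R) -intrB h1.
Qed.

(** Four batches buy one factor [t], by [(8 * t) ^+ 4 = (16 * t) ^+ 3 * t]; hence the [4 * C] in the
    choice of [C']. *)
Lemma median_failure_le_powR (R : realType) (t y : R) (L : nat) :
  0 < t -> t <= 1 / 16 -> 4 * y <= L%:R -> (8 * t) ^+ L <= t `^ y.
Proof.
move=> t0 t16 yL.
have t8 : 0 <= 8 * t by rewrite mulr_ge0// ltW.
have step : (8 * t) ^+ 4 <= t.
  have -> : (8 * t) ^+ 4 = (16 * t) ^+ 3 * t by ring.
  by rewrite ler_piMl ?(ltW t0)// exprn_ile1 ?mulr_ge0 ?(ltW t0)//; lra.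
have -> : (8 * t) ^+ L = ((8 * t) ^+ 4) `^ (L%:R / 4).
  by rewrite -powR_mulrn// -[in RHS]powR_mulrn// -powRrM mulrCA divff ?mulr1.
apply: (@le_trans _ _ (t `^ (L%:R / 4))).
  by apply: ge0_ler_powR => //; rewrite ?nnegrE ?divr_ge0 ?exprn_ge0// ltW.
apply: ger_powR; first by rewrite t0 /=; lra.
by lra.
Qed.

(** With [k = t / rho] and [8 * t <= 1/2], the exponent is split as [n + 5 + 1]: the first [n]
    factors give at most [2 ^- n <= 1 / (n + 1) <= 1 / k], five more give [1 / 32], and the last one
    is kept as [8 * t]. The product [8 * t / (32 * k)] is [rho / 4]. *)
Lemma median_failure_le_quarter (R : realType) (t rho : R) (L : nat) :
  0 < rho -> rho <= t -> t <= 1 / 16 -> 16 * t ^+ 2 / rho ^+ 2 <= L%:R ->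
  (8 * t) ^+ L <= rho / 4.
Proof.
move=> rho0 rt t16 hL; have t0 := lt_le_trans rho0 rt.
pose k := t / rho.
have k1 : 1 <= k by rewrite ler_pdivlMr// mul1r.
have hk : 16 * k <= L%:R.
  apply: le_trans hL; rewrite -mulrA -expr_div_n ler_pM2l//.
  by rewrite expr2 ler_peMl// (le_trans ler01).
have L6 : (6 <= L)%N by rewrite -(ler_nat R); lra.
have [n Ln] : exists n, L = (n + 6)%N by exists (L - 6)%N; rewrite subnK.
have t8 : 0 <= 8 * t by rewrite mulr_ge0// ltW.
have n2 : n%:R + 1 <= 2 ^+ n :> R.
  by rewrite -[2 ^+ n]natrX -[1]/(1%:R) -natrD ler_nat addn1 ltn_expl.
have kn : k <= n%:R + 1 by move: hk; rewrite Ln natrD; lra.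
have pn : (8 * t) ^+ n <= (2 ^+ n)^-1.
  by rewrite -exprVn lerXn2r ?nnegrE//; lra.
have p5 : (8 * t) ^+ 5 <= (2 ^+ 5)^-1.
  by rewrite -exprVn lerXn2r ?nnegrE//; lra.
have pk : (8 * t) ^+ n <= k^-1.
  apply: (le_trans pn); rewrite lef_pV2 ?posrE ?exprn_gt0//; last by lra.
  exact: le_trans kn n2.
rewrite Ln exprD exprSr.
have -> : rho / 4 = k^-1 * ((2 ^+ 5)^-1 * (8 * t)).
  by rewrite /k; field; rewrite !gt_eqF.
have h6 : (8 * t) ^+ 5 * (8 * t) <= (2 ^+ 5)^-1 * (8 * t) by rewrite ler_wpM2r.
apply: ler_pM => //; first exact: exprn_ge0.
by rewrite mulr_ge0 // exprn_ge0.
Qed.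

(** * Correctness and replicability *)

Section tester_failure.
Context d (X : measurableType d) (R : realType) (H0 H1 : set (probability X R))
  (S : expectation_gap_statistic H0 H1) (t : R) (L m : nat).
Let Rm := measurableTypeR R.
Hypotheses (t_gt0 : 0 < t) (t_le : t <= 1 / 16) (adm : admissible S t m).

Let Z : {mfun m.-tuple X >-> Rm} := stat S m.
Let A : algorithm X Rm (L * m) := median_mean_tester S L m.
Let rule := threshold_rule (tau0 S m) (tau1 S m).

Lemma measurable_tester :
  measurable_fun [set: (L * m).-tuple X * Rm] (fun w => A w.1 w.2).
Proof.
have mrule := @measurable_threshold_rule R (tau0 S m) (tau1 S m) L.
have mbm := @measurable_batch_map _ _ X Rm L m Z.
have mpair : measurable_fun [set: (L * m).-tuple X * Rm]
    (fun w => (batch_map Z w.1, w.2) : L.-tuple Rm * Rm).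
  apply: measurable_fun_pair => //.
  exact: (measurableT_comp mbm measurable_fst).
exact: (measurableT_comp mrule mpair).
Qed.

Lemma measurable_tester_neq (b : Rm -> bool) : measurable_fun [set: Rm] b ->
  measurable [set w : (L * m).-tuple X * Rm | A w.1 w.2 != b w.2].
Proof.
move=> mb; apply: measurable_neq_bool; first exact: measurable_tester.
exact: (measurableT_comp mb measurable_snd).
Qed.

Let tester_law (P : probability X R) (mu : probability Rm R) (b : Rm -> bool) :
  measurable_fun [set: Rm] b ->
  ((iid P (L * m) \x mu) [set w | A w.1 w.2 != b w.2] =
   (iid (distribution (iid P m) Z) L \x mu)
     [set w : L.-tuple Rm * Rm | rule w.1 w.2 != b w.2])%E.
Proof.
move=> mb; rewrite -(iid_batch_map_prod P mu Z)//.
apply: measurable_neq_bool; first exact: measurable_threshold_rule.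
exact: (measurableT_comp mb measurable_snd).
Qed.

Lemma tester_failure_low (P : probability X R) (mu : probability Rm R) :
  ('E_(iid P m)[stat S m] <= (tau0 S m)%:E)%E ->
  ((iid P (L * m) \x mu) [set w | A w.1 w.2 != true] <= ((8 * t) ^+ L)%:E)%E.
Proof.
rewrite stat_expectation lee_fin => cle.
have [gap0 [var_eq var_le]] := stat_law_variance_le P adm.
rewrite (tester_law P mu (b := cst true))//.
apply: (threshold_rule_low_failure (stat_law_integrable S P m)
  (stat_law_mean S P m) var_eq) => //.
by rewrite -subr_gt0.
Qed.

Lemma tester_failure_high (P : probability X R) (mu : probability Rm R) :
  ((tau1 S m)%:E <= 'E_(iid P m)[stat S m])%E ->
  ((iid P (L * m) \x mu) [set w | A w.1 w.2 != false] <= ((8 * t) ^+ L)%:E)%E.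
Proof.
rewrite stat_expectation lee_fin => cge.
have [gap0 [var_eq var_le]] := stat_law_variance_le P adm.
rewrite (tester_law P mu (b := cst false))//.
apply: (threshold_rule_high_failure (stat_law_integrable S P m)
  (stat_law_mean S P m) var_eq) => //.
by rewrite -subr_gt0.
Qed.

Lemma output_probE (P : probability X R) (mu : probability Rm R) (b : bool) :
  output_prob mu P A b =
  (1 - (iid P (L * m) \x mu) [set w | A w.1 w.2 != b])%E.
Proof.
have mN := measurable_tester_neq (measurable_cst b).
rewrite /output_prob -(probability_setC _ mN); congr (product_measure1 _ _ _).
by apply/seteqP; split => w /=; [move=> ->; rewrite eqxx|move=> /negP; rewrite negbK => /eqP].
Qed.

(* The answer [b r] depends on the threshold only, so two runs that share the
   threshold agree unless one of them deviates from [b]. *)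
Lemma tester_consensus (P : probability X R) (rho : R) :
  0 < rho -> 16 * t ^+ 2 / rho ^+ 2 <= L%:R -> (0 < L)%N ->
  exists2 b : Rm -> bool, measurable_fun [set: Rm] b &
    ((iid P (L * m) \x unif_threshold R) [set w | A w.1 w.2 != b w.2] <=
     ((8 * t) ^+ L + rho / 4)%:E)%E.
Proof.
move=> rho0 hL L0.
have weaken : ((8 * t) ^+ L <= (8 * t) ^+ L + rho / 4)%R.
  by rewrite lerDl divr_ge0// ltW.
have := stat_expectation S P m; set c := fine _ => Ec.
have [gap0 [var_eq var_le]] := stat_law_variance_le P adm.
have [ct0|t0c] := leP c (tau0 S m).
  exists (cst true) => //; apply: le_trans (tester_failure_low _ _) _ => //.
  by rewrite Ec lee_fin.
have [t1c|ct1] := leP (tau1 S m) c.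
  exists (cst false) => //; apply: le_trans (tester_failure_high _ _) _ => //.
  by rewrite Ec lee_fin.
pose b (r : Rm) := c <= tau0 S m + r * (tau1 S m - tau0 S m).
have mb : measurable_fun [set: Rm] b.
  apply: measurable_fun_ler; first exact: measurable_cst.
  apply: measurable_funD; first exact: measurable_cst.
  by apply: measurable_funM => //; exact: measurable_cst.
exists b => //; rewrite (tester_law P (unif_threshold R) mb).
apply: (threshold_rule_mid_failure (stat_law_integrable S P m)
  (stat_law_mean S P m) var_eq) => //.
- by rewrite -subr_gt0.
- by rewrite (ltW t0c) (ltW ct1).
Qed.

(** Union bound over the two runs: each departs from the consensus with probability at most
    [rho / 4 + rho / 4]. *)
Lemma tester_replicable (rho : R) :
  0 < rho -> 16 * t ^+ 2 / rho ^+ 2 <= L%:R -> (0 < L)%N ->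
  (8 * t) ^+ L <= rho / 4 -> replicable (unif_threshold R) rho A.
Proof.
move=> rho0 hL L0 hq P.
have [b mb hb] := tester_consensus P rho0 hL L0.
set mu := unif_threshold R; set I := iid P (L * m).
have mB := measurable_tester_neq mb.
set B := [set w | _] in mB.
pose B1 := [set w : (L * m).-tuple X * (L * m).-tuple X * Rm | B (w.1.1, w.2)].
pose B2 := [set w : (L * m).-tuple X * (L * m).-tuple X * Rm | B (w.1.2, w.2)].
have mfst : measurable_fun [set: (L * m).-tuple X * (L * m).-tuple X * Rm]
    (fun w => (w.1.1, w.2)).
  apply: measurable_fun_pair => //.
  exact: (measurableT_comp measurable_fst measurable_fst).
have msnd : measurable_fun [set: (L * m).-tuple X * (L * m).-tuple X * Rm]
    (fun w => (w.1.2, w.2)).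
  apply: measurable_fun_pair => //.
  exact: (measurableT_comp measurable_snd measurable_fst).
have mB1 : measurable B1 by rewrite -[X in measurable X]setTI; exact: mfst.
have mB2 : measurable B2 by rewrite -[X in measurable X]setTI; exact: msnd.
have mD : measurable [set w : (L * m).-tuple X * (L * m).-tuple X * Rm |
    A w.1.1 w.2 != A w.1.2 w.2].
  apply: measurable_neq_bool.
    exact: (measurableT_comp measurable_tester mfst).
  exact: (measurableT_comp measurable_tester msnd).
have -> : [set w : (L * m).-tuple X * (L * m).-tuple X * Rm |
    A w.1.1 w.2 = A w.1.2 w.2] = ~` [set w | A w.1.1 w.2 != A w.1.2 w.2].
  by apply/seteqP; split => w /=; [move=> ->; rewrite eqxx|move=> /negP; rewrite negbK => /eqP].
rewrite probability_setC// EFinB leeB//.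
apply: (@le_trans _ _ (((I \x I) \x mu) (B1 `|` B2))%E).
  apply: le_measure; rewrite ?inE//; first exact: measurableU.
  move=> w /= neq; rewrite /B1 /B2 /B /=.
  by have [<-|] := eqVneq (A w.1.1 w.2) (b w.2); [right; rewrite eq_sym|left].
apply: le_trans (measureU2 _ mB1 mB2) _.
rewrite [X in (X + _)%E](product_marginal13 I I mu mB).
rewrite [X in (_ + X)%E](product_marginal23 I I mu mB).
by apply: (le_trans (leeD hb hb)); rewrite -EFinD lee_fin; lra.
Qed.

End tester_failure.
Theorem mainTheorem10 (R : realType) (C : R) (hC : 0 < C) :
  exists C' K : R, 0 < C' /\ 0 < K /\
  forall (d : measure_display) (X : measurableType d)
    (H0 H1 : set (probability X R)) (S : expectation_gap_statistic H0 H1)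
    (delta rho t : R) (hdelta : 0 <= delta) (hdelta_rho : delta <= rho)
    (hrho0 : 0 < rho) (hrho1 : rho <= 1) (hrho_t : rho <= t) (ht : t <= 1 / 16)
    (hm : exists m, admissible S t m),
  let m := min_samples hm in
  let L := num_batches C' t rho in
  let A : algorithm X (measurableTypeR R) (L * m)%N :=
    median_mean_tester S L m in
  let mu := unif_threshold R in
  [/\ (L * m)%N%:R <= K * (m%:R * t ^+ 2 / rho ^+ 2),
      forall P : probability X R, H0 P ->
        ((1 - t `^ (C * t ^+ 2 / rho ^+ 2))%:E <=
         output_prob mu P A true)%E,
      forall P : probability X R, H1 P ->
        ((1 - t `^ (C * t ^+ 2 / rho ^+ 2))%:E <=
         output_prob mu P A false)%E
    & replicable mu rho A].
Proof.
(* The 16 serves replicability and the [4 * C] the success probability. As [t ^+ 2 / rho ^+ 2 >= 1],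
   the extra 1 in [K] pays for rounding up in [num_batches]. *)
exists (Num.max 16 (4 * C)), (Num.max 16 (4 * C) + 1).
set C' := Num.max 16 (4 * C).
have C16 : 16 <= C' by rewrite le_max lexx.
have C4 : 4 * C <= C' by rewrite le_max lexx orbT.
have C'0 : 0 < C' by exact: lt_le_trans C16.
split=> //; split; first by rewrite addr_gt0.
move=> d X H0 H1 S delta rho t _ _ rho0 _ rho_t t16 hm m L A mu.
have t0 : 0 < t := lt_le_trans rho0 rho_t.
have adm : admissible S t m by rewrite /m /min_samples; case: ex_minnP.
have /andP[L_ge L_lt] := num_batches_itv (ltW C'0) (ltW t0) (ltW rho0).
rewrite -/L in L_ge L_lt.
have assoc x : x * t ^+ 2 / rho ^+ 2 = x * (t ^+ 2 / rho ^+ 2) by rewrite -mulrA.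
have ratio1 : 1 <= t ^+ 2 / rho ^+ 2.
  rewrite ler_pdivlMr ?exprn_gt0// mul1r.
  by rewrite lerXn2r ?nnegrE ?(ltW t0) ?(ltW rho0).
have ratio0 : 0 <= t ^+ 2 / rho ^+ 2 by exact: le_trans ler01 ratio1.
have L16 : 16 * t ^+ 2 / rho ^+ 2 <= L%:R.
  by apply: le_trans L_ge; rewrite !assoc ler_wpM2r.
have L4 : 4 * (C * t ^+ 2 / rho ^+ 2) <= L%:R.
  by apply: le_trans L_ge; rewrite !assoc mulrA ler_wpM2r.
have L0 : (0 < L)%N.
  by rewrite -(ltr_nat R); apply: lt_le_trans L16;
    rewrite assoc mulr_gt0// (lt_le_trans ltr01).
have fail_powR := median_failure_le_powR t0 t16 L4.
split.
- have -> : (C' + 1) * (m%:R * t ^+ 2 / rho ^+ 2) =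
      (C' + 1) * (t ^+ 2 / rho ^+ 2) * m%:R :> R.
    by rewrite assoc -mulrA [m%:R * _]mulrC.
  rewrite natrM ler_wpM2r//; apply: (le_trans (ltW L_lt)).
  by rewrite assoc mulrDl mul1r lerD2l.
- move=> P HP; rewrite output_probE EFinB leeB//.
  apply: le_trans (tester_failure_low L t0 t16 adm mu (stat_H0 S m HP)) _.
  by rewrite lee_fin.
- move=> P HP; rewrite output_probE EFinB leeB//.
  apply: le_trans (tester_failure_high L t0 t16 adm mu (stat_H1 S m HP)) _.
  by rewrite lee_fin.
- apply: (tester_replicable t0 t16 adm rho0 L16 L0).
  exact: median_failure_le_quarter.
Qed.
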